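(* When $n^\ell d^\ell=n^r d^r$ and both groups of agents have identical ordinal preferences (i.e. $\sigma^\ell_i=\sigma^\ell_{i'}$ for all $i,i'\in N^\ell$ and $\sigma^r_j=\sigma^r_{j'}$ for all $j,j'\in N^r$), a complete SD-DEF1 matching always exists and can be computed efficiently.
   Context: Write $[n]=\{0,\ldots,n-1\}$. There are two disjoint groups of agents, $N^\ell=[n^\ell]$ (left) and $N^r=[n^r]$ (right), of sizes $n^\ell$ and $n^r$. Every left agent has the same degree constraint $d^\ell$ and every right agent has the same degree constraint $d^r$. A (valid, many-to-many) matching is a binary $n^\ell\times n^r$ matrix $M$ in which every row sum is at most $d^\ell$ and every column sum is at most $d^r$; agents $i\in N^\ell$ and $j\in N^r$ are matched iff $M(i,j)=1$. The matching $M$ is complete if its total number of ones is $\min(n^\ell d^\ell,\,n^r d^r)$. Each left agent $i$ has a nonnegative valuation function over $N^r$, and $\sigma^\ell_i$ is a linear order over $N^r$ consistent with it (agents of strictly higher value are ranked higher, ties broken arbitrarily); likewise each right agent $j$ has a nonnegative valuation function over $N^\ell$ and a consistent linear order $\sigma^r_j$ over $N^\ell$. Here $\sigma^\ell_i(p)$ and $\sigma^r_j(p)$ denote the agent in position $p$ of the ranking, position $0$ being the most preferred. $M$ is SD-EF1 over $N^\ell$ if for all $i,i'\in N^\ell$ and all $t\in[n^r]$, $\sum_{p=0}^t M(i,\sigma^\ell_i(p))\ge \sum_{p=0}^t M(i',\sigma^\ell_i(p))-1$. It is SD-EF1 over $N^r$ if for all $j,j'\in N^r$ and all $t\in[n^\ell]$,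 $\sum_{p=0}^t M(\sigma^r_j(p),j)\ge \sum_{p=0}^t M(\sigma^r_j(p),j')-1$. $M$ is SD-DEF1 (stochastic-dominance double envy-free up to one match) if it is SD-EF1 over both $N^\ell$ and $N^r$.
   Formalization: The formal theorem also assumes min(n^l d^l, n^r d^r) ≤ n^l n^r (for nonempty groups: d^l ≤ n^r and d^r ≤ n^l); without it no complete matching exists, e.g. n^l = n^r = 1 and d^l = d^r = 2. *)

(* Defs.v *)
From HB Require Import structures.
From mathcomp Require Import all_boot all_order all_algebra all_fingroup.

Set Implicit Arguments.
Unset Strict Implicit.
Unset Printing Implicit Defensive.

Import Order.TTheory GRing.Theory Num.Theory.

(* A profile of linear orders is a family of permutations: [sigma i p] is the
   agent that [i] ranks in position [p], position 0 being the best. *)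
Definition consistent (R : realFieldType) (n m : nat)
    (v : 'I_n -> 'I_m -> R) (sigma : 'I_n -> 'S_m) : Prop :=
  forall (i : 'I_n) (p q : 'I_m),
    (v i (sigma i q) < v i (sigma i p))%R -> p < q.

Definition nonneg_valuation (R : realFieldType) (n m : nat)
    (v : 'I_n -> 'I_m -> R) : Prop :=
  forall i j, (0 <= v i j)%R.

Definition identical_preferences (n m : nat) (sigma : 'I_n -> 'S_m) : Prop :=
  forall i i' : 'I_n, sigma i = sigma i'.

Definition is_matching (nl nr dl dr : nat) (M : 'M[bool]_(nl, nr)) : Prop :=
  (forall i, \sum_(j < nr) M i j <= dl) /\
  (forall j, \sum_(i < nl) M i j <= dr).

Definition complete (nl nr dl dr : nat) (M : 'M[bool]_(nl, nr)) : Prop :=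
  \sum_(i < nl) \sum_(j < nr) M i j = minn (nl * dl) (nr * dr).

(* The "- 1" on one side of the inequality is moved to the other side as
   "+ 1", so that no truncated subtraction occurs. *)
Definition SD_EF1_left (nl nr : nat) (sigmal : 'I_nl -> 'S_nr)
    (M : 'M[bool]_(nl, nr)) : Prop :=
  forall (i i' : 'I_nl) (t : 'I_nr),
    \sum_(p < nr | p <= t) M i' (sigmal i p)
      <= \sum_(p < nr | p <= t) M i (sigmal i p) + 1.

Definition SD_EF1_right (nl nr : nat) (sigmar : 'I_nr -> 'S_nl)
    (M : 'M[bool]_(nl, nr)) : Prop :=
  forall (j j' : 'I_nr) (t : 'I_nl),
    \sum_(p < nl | p <= t) M (sigmar j p) j'
      <= \sum_(p < nl | p <= t) M (sigmar j p) j + 1.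

Definition SD_DEF1 (nl nr : nat) (sigmal : 'I_nl -> 'S_nr)
    (sigmar : 'I_nr -> 'S_nl) (M : 'M[bool]_(nl, nr)) : Prop :=
  SD_EF1_left sigmal M /\ SD_EF1_right sigmar M.

(* Model of computation: unit-cost random access machine programs over
   natural numbers, with scalar variables and arrays named by numbers (a
   program mentions only finitely many names). The only arithmetic is addition
   and truncated subtraction, so the bit length of the values grows by at most
   one per step and running time on this machine agrees with Turing machine
   time up to a polynomial; unit-cost multiplication would break this. *)
Record state := State { var : nat -> nat; arr : nat -> nat -> nat }.

Inductive program : Type :=
| Skip
| Const of nat & nat                  (* Const x n     x := n             *)
| Add of nat & nat & nat              (* Add x y z     x := y + z         *)
| Sub of nat & nat & nat              (* Sub x y z     x := y - z         *)
| Read of nat & nat & nat             (* Read x a y    x := a[y]          *)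
| Write of nat & nat & nat            (* Write a x y   a[x] := y          *)
| Seq of program & program
| If of nat & nat & program & program (* If x y P Q    branches on x < y  *)
| While of nat & nat & program.       (* While x y P   loops while x < y  *)

Definition set_var (s : state) (x n : nat) : state :=
  State [eta var s with x |-> n] (arr s).

Definition set_arr (s : state) (a k n : nat) : state :=
  State (var s) (fun b i => if (b == a) && (i == k) then n else arr s b i).

(* [exec P s t s']: started in [s], program [P] halts in [s'] after exactly
   [t] elementary instructions and tests. *)
Inductive exec : program -> state -> nat -> state -> Prop :=
| ExecSkip s : exec Skip s 1 s
| ExecConst s x n : exec (Const x n) s 1 (set_var s x n)
| ExecAdd s x y z : exec (Add x y z) s 1 (set_var s x (var s y + var s z))
| ExecSub s x y z : exec (Sub x y z) s 1 (set_var s x (var s y - var s z))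
| ExecRead s x a y : exec (Read x a y) s 1 (set_var s x (arr s a (var s y)))
| ExecWrite s a x y : exec (Write a x y) s 1 (set_arr s a (var s x) (var s y))
| ExecSeq P Q s s' s'' t t' of exec P s t s' & exec Q s' t' s'' :
    exec (Seq P Q) s (t + t') s''
| ExecIfT x y P Q s s' t of var s x < var s y & exec P s t s' :
    exec (If x y P Q) s t.+1 s'
| ExecIfF x y P Q s s' t of var s y <= var s x & exec Q s t s' :
    exec (If x y P Q) s t.+1 s'
| ExecWhileT x y P s s' s'' t t' of var s x < var s y & exec P s t s'
    & exec (While x y P) s' t' s'' :
    exec (While x y P) s (t + t').+1 s''
| ExecWhileF x y P s of var s y <= var s x : exec (While x y P) s 1 s.

(* Variables 0 to 3 hold the sizes and the degree constraints; arrays 0 and 1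
   hold the two preference profiles, row by row. The rest of the memory is
   unconstrained, so a correct program must not rely on its contents. *)
Definition encodes_input (nl nr dl dr : nat)
    (sigmal : 'I_nl -> 'S_nr) (sigmar : 'I_nr -> 'S_nl) (s : state) : Prop :=
  [/\ var s 0 = nl /\ var s 1 = nr,
      var s 2 = dl /\ var s 3 = dr,
      forall (i : 'I_nl) (p : 'I_nr), arr s 0 (i * nr + p) = sigmal i p
    & forall (j : 'I_nr) (p : 'I_nl), arr s 1 (j * nl + p) = sigmar j p].

(* The matching is read off array 2, row by row. *)
Definition encodes_output (nl nr : nat) (M : 'M[bool]_(nl, nr)) (s : state) :
    Prop :=
  forall (i : 'I_nl) (j : 'I_nr), arr s 2 (i * nr + j) = M i j.

Definition computes_within (P : program) (T nl nr dl dr : nat)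
    (sigmal : 'I_nl -> 'S_nr) (sigmar : 'I_nr -> 'S_nl)
    (M : 'M[bool]_(nl, nr)) : Prop :=
  forall s, encodes_input dl dr sigmal sigmar s ->
    exists t s', [/\ exec P s t s', t <= T & encodes_output M s'].

(* Main.v *)
(* With identical preferences, agents may be named by their rank, so one needs
   a 0/1 matrix whose rows have prefix sums within 1 of each other, and likewise
   its columns. The density rho = dl / nr = dr / nl is the same along rows and
   columns, and the Hankel matrix with entries
   floor ((a + b + 1) rho) - floor ((a + b) rho) works: the sum of t consecutive
   values along a row or a column telescopes to floor (t rho) or
   floor (t rho) + 1. The entries are produced by keeping (a + b) * dl modulo nr
   in an accumulator. *)
Require Import Defs.
From mathcomp Require Import all_boot all_order all_algebra all_fingroup.
From mathcomp Require Import zify.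

Set Implicit Arguments.
Unset Strict Implicit.
Unset Printing Implicit Defensive.

(* The mechanical word of slope d / n: for d <= n, the x-th letter is
   floor ((x + 1) d / n) - floor (x d / n). *)
Definition mech (n d x : nat) : bool := n <= (x * d) %% n + d.

(** * Balance of mechanical words *)

Section MechanicalWord.
Variables (n d : nat).
Hypotheses (n_gt0 : 0 < n) (le_dn : d <= n).

(** As [d <= n], adding [d] to a remainder modulo [n] carries at most once, and the letter records
    that carry. *)
Lemma mechS x : x.+1 * d %/ n = x * d %/ n + mech n d x.
Proof.
have lt_mod : (x * d) %% n < n by rewrite ltn_mod.
rewrite mulSn addnC {1}(divn_eq (x * d) n) -addnA divnMDl //; congr (_ + _).
rewrite /mech; case: leqP => [ge_n | /divn_small -> //].
by rewrite -(subnK ge_n) -{3}[n]mul1n divnDMl // divn_small //; lia.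
Qed.

Lemma modn_mechS x :
  x.+1 * d %% n = (x * d) %% n + d - (if mech n d x then n else 0).
Proof.
have lt_mod : (x * d) %% n < n by rewrite ltn_mod.
rewrite mulSn addnC -modnDml /mech; case: leqP => [ge_n | lt_n].
  by rewrite -{1}(subnK ge_n) modnDr modn_small //; lia.
by rewrite subn0 modn_small.
Qed.

Lemma sum_mech s t : s * d %/ n + \sum_(k < t) mech n d (s + k) = (s + t) * d %/ n.
Proof.
elim: t => [|t IHt]; first by rewrite big_ord0 !addn0.
by rewrite big_ord_recr /= addnA IHt addnS mechS.
Qed.

Lemma sum_mech_period s : \sum_(k < n) mech n d (s + k) = d.
Proof.
by have := sum_mech s n; rewrite mulnDl [n * d]mulnC divnDMl // => /addnI.
Qed.

Lemma sum_mech_balanced s s' m (t : 'I_m) :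
  \sum_(k < m | k <= t) mech n d (s + k)
    <= \sum_(k < m | k <= t) mech n d (s' + k) + 1.
Proof.
have prefixE (F : nat -> nat) : \sum_(k < m | k <= t) F k = \sum_(k < t.+1) F k.
  by rewrite (big_ord_widen m F (ltn_ord t)).
rewrite (prefixE (fun k => mech n d (s + k))) (prefixE (fun k => mech n d (s' + k))).
move: (t.+1) => {prefixE} {}t.
have := sum_mech s t; have := sum_mech s' t.
(* Both windows sum to [t * d %/ n] plus the carry of two remainders; the starting point affects
   only this carry bit. *)
rewrite !mulnDl !divnD //.
by case: (n <= _); case: (n <= _); lia.
Qed.

End MechanicalWord.

Lemma mech_scale k n d x : 0 < k -> mech (k * n) (k * d) x = mech n d x.
Proof. by move=> k_gt0; rewrite /mech mulnCA -muln_modr -mulnDr leq_pmul2l. Qed.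

(** Scaling ([nr], [dl]) by [nl] and ([nl], [dr]) by [nr] gives the same pair, so columns are
    windows of the same word as rows. *)
Lemma mech_transpose nl nr dl dr x : 0 < nl -> 0 < nr -> nl * dl = nr * dr ->
  mech nr dl x = mech nl dr x.
Proof.
move=> nl_gt0 nr_gt0 e.
by rewrite -(mech_scale _ _ x nl_gt0) e mulnC mech_scale.
Qed.

(** * The matching and its fairness *)

Section Matching.
Variables (nl nr dl dr : nat) (sl : 'S_nr) (sr : 'S_nl).
Hypotheses (nl_gt0 : 0 < nl) (nr_gt0 : 0 < nr).
Hypotheses (le_dl : dl <= nr) (le_dr : dr <= nl) (eq_m : nl * dl = nr * dr).

(** The inverse permutations turn agents into ranks; the matrix is Hankel once its lines are sorted
    by rank. *)
Definition mech_matching : 'M[bool]_(nl, nr) :=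
  \matrix_(i, j) mech nr dl ((sr^-1)%g i + (sl^-1)%g j).

Lemma mech_matchingE a b : mech_matching (sr a) (sl b) = mech nr dl (a + b).
Proof. by rewrite mxE !permK. Qed.

Lemma mech_matching_row i b :
  mech_matching i (sl b) = mech nr dl ((sr^-1)%g i + b).
Proof. by rewrite mxE permK. Qed.

Lemma mech_matching_col a j :
  mech_matching (sr a) j = mech nl dr ((sl^-1)%g j + a).
Proof. by rewrite mxE permK addnC (mech_transpose _ _ _ eq_m). Qed.

Lemma mech_matching_row_sum i : \sum_(j < nr) mech_matching i j = dl.
Proof.
rewrite (reindex_inj (@perm_inj _ sl)) /=.
under eq_bigr => b _ do rewrite mech_matching_row.
exact: sum_mech_period.
Qed.

Lemma mech_matching_col_sum j : \sum_(i < nl) mech_matching i j = dr.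
Proof.
rewrite (reindex_inj (@perm_inj _ sr)) /=.
under eq_bigr => a _ do rewrite mech_matching_col.
exact: sum_mech_period.
Qed.

Lemma is_matching_mech : is_matching dl dr mech_matching.
Proof.
by split=> k; rewrite ?mech_matching_row_sum ?mech_matching_col_sum.
Qed.

Lemma complete_mech : complete dl dr mech_matching.
Proof.
rewrite /complete -eq_m minnn.
under eq_bigr => i _ do rewrite mech_matching_row_sum.
by rewrite sum_nat_const card_ord.
Qed.

Lemma SD_EF1_left_mech : SD_EF1_left (fun=> sl) mech_matching.
Proof.
move=> i i' t.
under eq_bigr => b _ do rewrite mech_matching_row.
under [in leqRHS]eq_bigr => b _ do rewrite mech_matching_row.
exact: sum_mech_balanced.
Qed.

Lemma SD_EF1_right_mech : SD_EF1_right (fun=> sr) mech_matching.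
Proof.
move=> j j' t.
under eq_bigr => a _ do rewrite mech_matching_col.
under [in leqRHS]eq_bigr => a _ do rewrite mech_matching_col.
exact: sum_mech_balanced.
Qed.

End Matching.

(** * Timed weakest preconditions *)

Definition runs (P : program) (s : state) (T : nat) (Q : state -> Prop) : Prop :=
  exists t s', [/\ exec P s t s', t <= T & Q s'].

Lemma runs_weaken P s T T' (Q Q' : state -> Prop) :
  runs P s T Q -> T <= T' -> (forall s', Q s' -> Q' s') -> runs P s T' Q'.
Proof.
move=> [t [s' [ex le_tT Qs']]] le_TT' QQ'; exists t, s'.
by split; [| exact: leq_trans le_TT' | exact: QQ'].
Qed.

Lemma runs_seq P1 P2 s T1 T2 Q :
  runs P1 s T1 (fun s' => runs P2 s' T2 Q) -> runs (Seq P1 P2) s (T1 + T2) Q.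
Proof.
move=> [t1 [s1 [ex1 le1 [t2 [s2 [ex2 le2 Qs2]]]]]].
by exists (t1 + t2), s2; split; [exact: ExecSeq ex2 | exact: leq_add |].
Qed.

(** [Inv] is indexed by a pass counter that decides the guard. Each pass costs its body plus one
    test, and the final failing test adds 1. *)
Lemma runs_while x y P n T (Inv : nat -> state -> Prop) k s :
  (forall k s, Inv k s -> (var s x < var s y) = (k < n)) ->
  (forall k s, k < n -> Inv k s -> runs P s T (Inv k.+1)) ->
  k <= n -> Inv k s -> runs (While x y P) s ((n - k) * T.+1 + 1) (Inv n).
Proof.
move=> guard body /subnKC; move: (n - k) => m; elim: m k s => [|m IHm] k s nE Is.
  have <- : k = n by lia.
  exists 1, s; split=> //; apply: ExecWhileF.
  by rewrite leqNgt (guard _ _ Is) -nE addn0 ltnn.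
have lt_kn : k < n by lia.
have [t [s' [ex le_t Is']]] := body k s lt_kn Is.
have [|t' [s'' [ex' le_t' Is'']]] := IHm k.+1 s' _ Is'; first lia.
exists (t + t').+1, s''; split=> //; last by lia.
by apply: ExecWhileT ex'; rewrite ?(guard _ _ Is).
Qed.

Fixpoint loop_free (P : program) : bool :=
  match P with
  | While _ _ _ => false
  | Seq P Q | If _ _ P Q => loop_free P && loop_free Q
  | _ => true
  end.

Fixpoint cost (P : program) : nat :=
  match P with
  | Seq P Q => cost P + cost Q
  | If _ _ P Q => (maxn (cost P) (cost Q)).+1
  | _ => 1
  end.

(* Meaningful on loop-free programs only. *)
Fixpoint eval (P : program) (s : state) : state :=
  match P with
  | Skip => s
  | Const x n => set_var s x n
  | Add x y z => set_var s x (var s y + var s z)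
  | Defs.Sub x y z => set_var s x (var s y - var s z)
  | Read x a y => set_var s x (arr s a (var s y))
  | Write a x y => set_arr s a (var s x) (var s y)
  | Seq P Q => eval Q (eval P s)
  | If x y P Q => if var s x < var s y then eval P s else eval Q s
  | While _ _ _ => s
  end.

(** Symbolic execution of loop-free code: a run reduces to computing [eval], with the dearer branch
    charged. *)
Lemma runs_eval P s (Q : state -> Prop) :
  loop_free P -> Q (eval P s) -> runs P s (cost P) Q.
Proof.
move=> lfP Qs.
suff [t ex le_t] : exists2 t, exec P s t (eval P s) & t <= cost P.
  by exists t, (eval P s).
elim: P s lfP {Qs} => //=; try by move=> *; exists 1 => //; constructor.
  move=> P1 IH1 P2 IH2 s /andP[/(IH1 s)[t1 ex1 le1] /(IH2 (eval P1 s))[t2 ex2 le2]].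
  by exists (t1 + t2); [exact: ExecSeq ex2 | exact: leq_add].
move=> x y P1 IH1 P2 IH2 s /andP[/(IH1 s)[t1 ex1 le1] /(IH2 s)[t2 ex2 le2]].
case: ltnP => xy.
  by exists t1.+1; [exact: ExecIfT | rewrite ltnS leq_max le1].
by exists t2.+1; [exact: ExecIfF | rewrite ltnS leq_max le2 orbT].
Qed.

(** * The program *)

Local Notation v_nl := 0 (only parsing).
Local Notation v_nr := 1 (only parsing).
Local Notation v_dl := 2 (only parsing).
Local Notation v_one := 4 (only parsing).
Local Notation v_a := 5 (only parsing).
Local Notation v_acc := 6 (only parsing).
Local Notation v_i := 7 (only parsing).
Local Notation v_off := 8 (only parsing).
Local Notation v_cnt := 9 (only parsing).
Local Notation v_b := 10 (only parsing).
Local Notation v_idx := 11 (only parsing).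
Local Notation v_bit := 12 (only parsing).

(** When [dl <= nr], one conditional subtraction reduces the accumulator modulo [nr], and whether it
    occurs is the next letter. *)
Definition advance : program :=
  Seq (Add v_acc v_acc v_dl)
      (If v_acc v_nr (Const v_bit 0)
                     (Seq (Defs.Sub v_acc v_acc v_nr) (Const v_bit 1))).

Definition row_start : program :=
  Seq (Read v_i 1 v_a) (Seq (Const v_off 0) (Seq (Const v_cnt 0) (Const v_b 0))).

(** Iterated, this builds the address of a row by repeated addition in place of multiplication. *)
Definition add_row_length : program :=
  Seq (Add v_off v_off v_nr) (Add v_cnt v_cnt v_one).

Definition fill_entry : program :=
  Seq (Read v_idx 0 v_b) (Seq (Add v_idx v_idx v_off)
    (Seq advance (Seq (Write 2 v_idx v_bit) (Add v_b v_b v_one)))).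

(* Filling a row moves the accumulator by nr * dl, which is 0 modulo nr. *)
Definition fill_row : program :=
  Seq row_start (Seq (While v_cnt v_i add_row_length)
    (Seq (While v_b v_nr fill_entry) (Seq advance (Add v_a v_a v_one)))).

(* The guard keeps the program from reading preferences that do not exist:
   junk values of v_i could make the running time unbounded. *)
Definition matching_program : program :=
  Seq (Seq (Const v_a 0) (Seq (Const v_acc 0) (Const v_one 1)))
      (If v_a v_nr (While v_a v_nl fill_row) Skip).

(** * Invariants and running time of the program *)

Section Correctness.
Variables (nl nr dl : nat) (I J : nat -> nat).
Hypotheses (nr_gt0 : 0 < nr) (le_dl : dl <= nr).
Hypotheses (I_lt : forall a, a < nl -> I a < nl).
Hypotheses (I_inj : {in gtn nl &, injective I}).
Hypotheses (J_lt : forall b, b < nr -> J b < nr).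
Hypotheses (J_inj : {in gtn nr &, injective J}).

Local Notation idx a b := (I a * nr + J b).

(** Since [J b < nr], division by [nr] recovers [I a]. Hence no write destroys an earlier entry. *)
Lemma idx_inj a b a' b' : a < nl -> b < nr -> a' < nl -> b' < nr ->
  idx a b = idx a' b' -> a = a' /\ b = b'.
Proof.
move=> la lb la' lb' e.
have eI : I a = I a'.
  have := congr1 (divn^~ nr) e.
  by rewrite !divnMDl // !divn_small ?addn0 ?J_lt.
split; first exact: I_inj.
by apply: J_inj => //; move: e; rewrite eI => /addnI.
Qed.

Definition filled (s : state) (a b : nat) : Prop :=
  forall a' b', a' < nl -> b' < nr -> a' < a \/ a' = a /\ b' < b ->
    arr s 2 (idx a' b') = mech nr dl (a' + b').

Record inv (a b : nat) (s : state) : Prop := Inv {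
  inv_sizes : [/\ var s v_nl = nl, var s v_nr = nr, var s v_dl = dl & var s v_one = 1];
  inv_a : var s v_a = a;
  inv_acc : var s v_acc = (a + b) * dl %% nr;
  inv_arr : (forall k, k < nl -> arr s 1 k = I k) /\
            (forall k, k < nr -> arr s 0 k = J k);
  inv_filled : filled s a b }.

Lemma runs_fill_entry a b s : a < nl -> b < nr ->
    inv a b s -> var s v_off = I a * nr -> var s v_b = b ->
  runs fill_entry s (cost fill_entry)
    (fun s' => [/\ inv a b.+1 s', var s' v_off = I a * nr & var s' v_b = b.+1]).
Proof.
move=> la lb [[s0 s1 s2 s4] s5 s6 [sI sJ] sF] s8 s10.
have accE := modn_mechS nr_gt0 le_dl (a + b).
apply: runs_eval => //=.
rewrite s1 s2 s6.
(* Shared by both outcomes of the carry test, with [x] the bit written. *)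
have filledS s' x : x = mech nr dl (a + b) :> nat ->
    arr s' 2 = (fun i => if i == idx a b then x else arr s 2 i) ->
  filled s' a b.+1.
  move=> xE aE a' b' la' lb' lt; rewrite aE; case: eqP => [/idx_inj e | ne].
    by have [//|//|//|//|-> ->] := e.
  apply: sF => //; case: lt => [|[ea lt]]; [by left | right; split=> //].
  suff : b' != b by lia.
  by apply/eqP=> eb; apply: ne; rewrite ea eb.
have [lt_n|ge_n] := ltnP; split=> //; try split=> //=; rewrite ?s1 ?s2 ?s6.
- by rewrite addnS accE /mech leqNgt lt_n subn0.
- apply: (filledS _ 0) => /=; first by rewrite /mech leqNgt lt_n.
  by rewrite s10 s8 sJ // addnC.
- by rewrite /= s10 s4 addn1.
- by rewrite addnS accE /mech ge_n.
- apply: (filledS _ 1) => /=; first by rewrite /mech ge_n.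
  by rewrite s10 s8 sJ // addnC.
- by rewrite /= s10 s4 addn1.
Qed.

Lemma runs_fill_row a s : a < nl -> inv a 0 s ->
  runs fill_row s (3 * nl + 12 * nr + 20) (inv a.+1 0).
Proof.
move=> la inv_s.
pose Inv1 k s := [/\ inv a 0 s, var s v_i = I a, var s v_off = k * nr,
                     var s v_cnt = k & var s v_b = 0].
pose Inv2 b s := [/\ inv a b s, var s v_off = I a * nr & var s v_b = b].
have start : Inv1 0 (eval row_start s).
  case: inv_s => -[s0 s1 s2 s4] s5 s6 [sI sJ] sF.
  by split=> //=; rewrite s5 sI.
have offset st : Inv1 0 st -> runs (While v_cnt v_i add_row_length) st
    (3 * nl + 1) (Inv1 (I a)).
  move=> Ist; apply: runs_weaken (runs_while (T := 2) _ _ (leq0n _) Ist) _ _ => //.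
  - by move=> k s' [_ -> _ ->].
  - move=> k s' lk [[[s0 s1 s2 s4] s5 s6 [sI sJ] sF] s7 s8 s9 s10].
    apply: runs_eval => //; split=> //=.
    + by rewrite s8 s1 mulSn addnC.
    + by rewrite s9 s4 addn1.
  (* The bound on [I a] limits the number of passes, each costing two additions and a test. *)
  - by have := I_lt la; lia.
  - by [].
have fill st : Inv2 0 st -> runs (While v_b v_nr fill_entry) st
    (12 * nr + 1) (Inv2 nr).
  move=> Ist.
  apply: runs_weaken (runs_while (T := cost fill_entry) _ _ (leq0n nr) Ist) _ _ => //.
  - by move=> k s' [[[_ -> _ _] _ _ _ _] _ ->].
  - by move=> k s' lk [? ? ?]; apply: runs_fill_entry.
  - by rewrite /=; lia.
apply: (@runs_weaken _ _ (cost row_start + (3 * nl + 1 + (12 * nr + 1 +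
  cost (Seq advance (Add v_a v_a v_one))))) _ (inv a.+1 0)) => //; last by rewrite /=; lia.
apply: runs_seq; apply: runs_eval => //; apply: runs_seq.
apply: runs_weaken (offset _ start) (leqnn _) _ => st [inv_st _ off1 _ b1].
apply: runs_seq; apply: runs_weaken (fill st _) (leqnn _) _ => //.
move=> s2 [[[e0 e1 e2 e4] e5 e6 [eI eJ] eF] e8 e10].
(* The closing [advance] only moves the accumulator to [a.+1 * dl] modulo [nr]; its bit is
   discarded. *)
have accE := modn_mechS nr_gt0 le_dl a.
have e6' : var s2 v_acc = a * dl %% nr by rewrite e6 mulnDl addnC mulnC modnMDl.
(* Lexicographically, the cells before ([a.+1], [0]) are those before ([a], [nr]). *)
have filledS s' : arr s' = arr s2 -> filled s' a.+1 0.
  move=> aE a' b' la' lb' lt; rewrite aE; apply: eF => //.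
  by lia.
apply: runs_eval => //=; rewrite e1 e2 e6'.
have [lt_n|ge_n] := ltnP; split=> //=; rewrite ?e1 ?e2 ?e4 ?e5 ?e6' ?addn1 ?addn0 //.
- by rewrite accE /mech leqNgt lt_n subn0.
- exact: filledS.
- by rewrite accE /mech ge_n.
- exact: filledS.
Qed.

Lemma runs_matching_program s :
    var s v_nl = nl -> var s v_nr = nr -> var s v_dl = dl ->
    (forall a, a < nl -> arr s 1 a = I a) ->
    (forall b, b < nr -> arr s 0 b = J b) ->
  runs matching_program s (nl * (3 * nl + 12 * nr + 21) + 5)
    (fun s' => filled s' nl 0).
Proof.
move=> s0 s1 s2 sI sJ.
have inv0 : inv 0 0 (eval (Seq (Const v_a 0) (Seq (Const v_acc 0) (Const v_one 1))) s).
  by split=> //=; [rewrite mod0n | move=> a' b' _ _; lia].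
apply: (@runs_weaken _ _ (3 + (nl * (3 * nl + 12 * nr + 21) + 1).+1)
  _ (fun s' => filled s' nl 0)) => //; last by lia.
apply: runs_seq; apply: runs_eval => //.
have guard k s' : inv k 0 s' -> (var s' v_a < var s' v_nl) = (k < nl).
  by move=> [[-> _ _ _] -> _ _ _].
have body k s' : k < nl -> inv k 0 s' ->
    runs fill_row s' (3 * nl + 12 * nr + 20) (inv k.+1 0).
  exact: runs_fill_row.
have [t [s' [ex le_t [_ _ _ _ sF]]]] := runs_while guard body (leq0n nl) inv0.
exists t.+1, s'; split=> //; last by lia.
by apply: ExecIfT ex; rewrite /= s1.
Qed.

End Correctness.

(** * Empty groups and the final assembly *)

Lemma runs_matching_program_empty s :
  var s v_nl = 0 \/ var s v_nr = 0 -> runs matching_program s 5 (fun=> True).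
Proof.
move=> empty.
apply: (@runs_weaken _ _ (3 + 2) _ (fun=> True)) => //.
apply: runs_seq; apply: runs_eval => //=.
(* If [v_nr] is 0 the guard fails; otherwise [v_nl] is 0 and the first loop test fails. *)
have [nr0|nr_gt0] := posnP (var s v_nr); eexists 2, _; split=> //.
  by apply: ExecIfF; [rewrite /= nr0 | constructor].
apply: ExecIfT => //; apply: ExecWhileF.
by case: empty => /= e; move: nr_gt0; rewrite e.
Qed.

(* The hypothesis on minn says that the number of ones required of a complete
   matching does not exceed the number of entries of the matrix; for nonempty
   groups it amounts to dl <= nr and dr <= nl. *)
Theorem theorem2 (R : realFieldType) :
  exists (P : program) (c k : nat),
  forall (nl nr dl dr : nat)
    (vl : 'I_nl -> 'I_nr -> R) (vr : 'I_nr -> 'I_nl -> R)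
    (sigmal : 'I_nl -> 'S_nr) (sigmar : 'I_nr -> 'S_nl),
  nonneg_valuation vl -> nonneg_valuation vr ->
  consistent vl sigmal -> consistent vr sigmar ->
  minn (nl * dl) (nr * dr) <= nl * nr ->
  nl * dl = nr * dr ->
  identical_preferences sigmal -> identical_preferences sigmar ->
  exists M : 'M[bool]_(nl, nr),
    [/\ is_matching dl dr M,
        complete dl dr M,
        SD_DEF1 sigmal sigmar M
      & computes_within P (c * (nl + nr) ^ k + c) dl dr sigmal sigmar M].
Proof.
(* For nonempty groups [3 * nl + 12 * nr + 21] is at most [33 * (nl + nr)], and the outer loop makes
   [nl] passes. *)
exists matching_program, 33, 2 => nl nr dl dr _ _ sigmal sigmar _ _ _ _.
move=> le_m eq_m idl idr; rewrite -eq_m minnn in le_m.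
have [/eqP|] := posnP (nl * nr).
  rewrite muln_eq0 => empty.
  have no_pair (i : 'I_nl) (j : 'I_nr) : False.
    by case/orP: empty => /eqP e; [case: i | case: j]; rewrite e.
  exists (const_mx false); split.
  - split=> k; rewrite big1 // => k' _; by [case: (no_pair k k') | case: (no_pair k' k)].
  - rewrite /complete -eq_m minnn big1 => [|i _].
      by case/orP: empty => /eqP e; [|rewrite eq_m]; rewrite e.
    by rewrite big1 // => j _; case: (no_pair i j).
  - by split=> k k' t; [case: (no_pair k t) | case: (no_pair t k)].
  - move=> s [[s0 s1] _ _ _].
    have [|t [s' [ex le_t _]]] := @runs_matching_program_empty s.
      by rewrite s0 s1; case/orP: empty => /eqP ->; [left | right].
    exists t, s'; split=> //; first by lia.
    by move=> i j; case: (no_pair i j).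
rewrite muln_gt0 => /andP[nl_gt0 nr_gt0].
have le_dl : dl <= nr by rewrite -(leq_pmul2l nl_gt0).
have le_dr : dr <= nl by rewrite -(leq_pmul2l nr_gt0) -eq_m [nr * nl]mulnC.
pose sl := sigmal (Ordinal nl_gt0); pose sr := sigmar (Ordinal nr_gt0).
exists (mech_matching dl sl sr); split.
- exact: is_matching_mech.
- exact: complete_mech.
- split=> k k' t.
    by rewrite (idl k (Ordinal nl_gt0)); exact: SD_EF1_left_mech.
  by rewrite (idr k (Ordinal nr_gt0)); exact: (SD_EF1_right_mech _ _ nl_gt0 nr_gt0 le_dr eq_m).
move=> s [[s0 s1] [s2 _] sl_arr sr_arr].
(* Preferences being identical, only the first row of each profile is read, hence the offset
   [0 * n]. *)
have row0 n m (f : 'S_m) (A : nat -> nat) :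
    (forall p : 'I_m, A (0 * n + p) = f p) ->
  [/\ forall k, k < m -> A k < m & {in gtn m &, injective A}].
  move=> Af; split=> [k lt_k | k k' lt_k lt_k'].
    by rewrite (Af (Ordinal lt_k)).
  rewrite (Af (Ordinal lt_k)) (Af (Ordinal lt_k')) => /val_inj/perm_inj.
  by case.
have [I_lt I_inj] := row0 nl nl sr (arr s 1) (sr_arr (Ordinal nr_gt0)).
have [J_lt J_inj] := row0 nr nr sl (arr s 0) (sl_arr (Ordinal nl_gt0)).
(* [I] and [J] are the stored arrays themselves, so agreement with memory is [erefl]. *)
have [t [s' [ex le_t sF]]] :=
  runs_matching_program nr_gt0 le_dl I_lt I_inj J_lt J_inj
    s0 s1 s2 (fun _ _ => erefl) (fun _ _ => erefl).
exists t, s'; split=> //; first by nia.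
(* [filled] speaks of ranks; looking up the ranks of [i] and [j] in the arrays returns the
   agents. *)
move=> i j; rewrite mxE -sF //; last by left.
have := sr_arr (Ordinal nr_gt0) ((sr^-1)%g i).
have := sl_arr (Ordinal nl_gt0) ((sl^-1)%g j).
by rewrite /= -/sl -/sr !permKV !add0n => -> ->.
Qed.
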